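(* For every prime $p>3$, $$\sum_{k=1}^{p-1} \frac{(-1)^k}{k}\binom{-\frac{1}{2}}{k} \equiv 2q_p(2)-p\,q_p(2)^2+\frac{2}{3}p^2q_p(2)^3+\frac{7}{12}p^2 B_{p-3} \equiv -\sum_{k=1}^{(p-1)/2}\frac{1}{k} \pmod{p^3}.$$
   Context: $\binom{-1/2}{k}=\frac{(-1/2)(-1/2-1)\cdots(-1/2-k+1)}{k!}$ is the generalized binomial coefficient. $q_p(2)=\frac{2^{p-1}-1}{p}$ is the Fermat quotient of $2$ base $p$. $B_n$ denotes the $n$-th Bernoulli number. For rationals $x,y$ whose denominators are prime to $p$, $x\equiv y \pmod{p^m}$ means that $(x-y)/p^m$ is a rational number with denominator prime to $p$. *)

(* Defs.v *)
From mathcomp Require Import all_boot all_order all_algebra.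
Set Implicit Arguments.
Unset Strict Implicit.
Unset Printing Implicit Defensive.
Import Order.TTheory GRing.Theory Num.Theory.
Local Open Scope ring_scope.

Definition gbinom (a : rat) (k : nat) : rat :=
  (\prod_(i < k) (a - i%:R)) / k`!%:R.

Definition fermat_quotient (a p : nat) : rat :=
  (a%:R ^+ p.-1 - 1) / p%:R.

(* The list [:: B_0; ...; B_(n-1)], from the recurrence
   \sum_(k <= m) 'C(m + 1, k) B_k = (m == 0), stated as bernoulli_rec below;
   this is the convention x / (e^x - 1) = \sum_n B_n x^n / n!, B_1 = -1/2. *)
Fixpoint bernoulli_seq (n : nat) : seq rat :=
  if n is m.+1 then
    let s := bernoulli_seq m in
    rcons s (((m == 0%N)%:R - \sum_(k < m) 'C(m.+1, k)%:R * s`_k) / m.+1%:R)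
  else [::].

Definition bernoulli (n : nat) : rat := (bernoulli_seq n.+1)`_n.

Lemma size_bernoulli_seq n : size (bernoulli_seq n) = n.
Proof. by elim: n => //= n IHn; rewrite size_rcons IHn. Qed.

Lemma nth_bernoulli_seq n k :
  (k < n)%N -> (bernoulli_seq n)`_k = bernoulli k.
Proof.
elim: n => // n IHn; rewrite ltnS leq_eqVlt => /orP[/eqP -> // | lt_kn].
by rewrite -IHn //= nth_rcons size_bernoulli_seq lt_kn.
Qed.

Lemma bernoulli_rec n :
  \sum_(k < n.+1) 'C(n.+1, k)%:R * bernoulli k = (n == 0%N)%:R.
Proof.
rewrite big_ord_recr /= binSn [X in _ + _ * X]/bernoulli /=.
rewrite nth_rcons size_bernoulli_seq ltnn eqxx mulrC divfK ?pnatr_eq0 //.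
rewrite (eq_bigr (fun k : 'I_n => 'C(n.+1, k)%:R * (bernoulli_seq n)`_k)).
  by rewrite addrC subrK.
by move=> k _; rewrite nth_bernoulli_seq.
Qed.

Definition p_integral (p : nat) (x : rat) : bool := coprime `|denq x|%N p.

Definition rat_eqmod (p m : nat) (x y : rat) : Prop :=
  [/\ p_integral p x, p_integral p y & p_integral p ((x - y) / p%:R ^+ m)].

(* Main.v *)
From HB Require Import structures.
Require Import Defs.
From mathcomp Require Import all_boot all_order all_algebra.
From mathcomp Require Import zify ring.
Import Order.TTheory GRing.Theory Num.Theory.
Local Open Scope ring_scope.

(** Let [n = (p-1)/2], and let [h_s], [G_s] be the sums of [1/k^s] over
    [1 <= k <= n] and [1 <= k <= p-1].  Pairing [k] with [p-k], and even [k]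
    with odd [p-k], expresses [h_2], [G_2] modulo [p^2] and [G_1] modulo [p^3]
    through [h_3]; the same two splittings of [sum k^(p-3) = p B_(p-3) mod p^2]
    (Faulhaber) give [h_3 = -2 B_(p-3) mod p].

    Second congruence: [1 + p q = 2^(p-1)] is the product of [1 + p/r] over the
    odd [r < p].  Taking a logarithm truncated after the cubic term expresses
    [q - p q^2/2 + p^2 q^3/3] through the sums of [r^-1], [r^-2], [r^-3], that
    is, through [h_1], [h_2], [h_3].

    First congruence: let [f a] be the sum of [(-1)^k/k binom(a,k)] over
    [1 <= k < p].  Since [a (f a - f (a-1)) = binom(a-1,p-1) - 1], its values
    at integers are explicit; in particular [f n = -h_1].  Modulo [p^3],
    [f (n + p t)] is quadratic in [t], so [f (-1/2) = f (n - p/2)] is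
    interpolated from [f n], [f (n-p)] and [f (n+p)].  The error is a nested
    harmonic sum, evaluated modulo [p] by expanding [f (p-1) = -G_1] in powers
    of [p]. *)

(** * The integers localized at [p] and the ideals generated by powers of [p] *)

(** Any denominator prime to [p] will do, so sums and products need no reduction to lowest terms. *)
Lemma p_integralP (p : nat) (x : rat) :
  reflect (exists2 d : nat, coprime d p & (0 < d)%N && (x * d%:R \is a Num.int))
          (p_integral p x).
Proof.
apply: (iffP idP) => [cop|[d cop /andP[d_gt0 /intrP[a xdE]]]].
  exists `|denq x|%N => //; rewrite absz_gt0 denq_neq0 /=.
  by rewrite natr_absz gtr0_norm ?denq_gt0 // -numqE intr_int.
rewrite /p_integral; apply: coprime_dvdl cop.
have numd : numq x * d%:Z = a * denq x.
  apply: (@intr_inj rat); rewrite !rmorphM /= numqE -xdE -pmulrn; ring.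
have : (denq x %| numq x * d%:Z)%Z by rewrite numd dvdz_mull.
rewrite Gauss_dvdzr ?dvdzE //.
by rewrite coprimezE coprime_sym coprime_num_den.
Qed.

Lemma p_integral_subring p : subring_closed (p_integral p : {pred rat}).
Proof.
have clos (op : rat -> rat -> rat) x y :
   (forall d e : rat, d \is a Num.int -> e \is a Num.int ->
      x * d \is a Num.int -> y * e \is a Num.int ->
      op x y * (d * e) \is a Num.int) ->
   p_integral p x -> p_integral p y -> p_integral p (op x y).
  move=> H /p_integralP[d cd /andP[d0 xd]] /p_integralP[e ce /andP[e0 ye]].
  apply/p_integralP; exists (d * e)%N; first by rewrite coprimeMl cd.
  by rewrite muln_gt0 d0 e0 natrM H // natr_int.
split.
- by apply/p_integralP; exists 1%N; rewrite ?coprime1n ?mulr1 ?int_num1.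
- move=> x y; rewrite !unfold_in.
  apply: (clos (fun x y => x - y)) => d e di ei xd ye.
  rewrite (_ : _ * _ = (x * d) * e - (y * e) * d); last by ring.
  by rewrite rpredB // rpredM.
- move=> x y; rewrite !unfold_in.
  apply: (clos *%R) => d e di ei xd ye.
  rewrite (_ : _ * _ = (x * d) * (y * e)); last by ring.
  by rewrite rpredM.
Qed.

Definition locint (p : nat) : {pred rat} := p_integral p.

HB.instance Definition _ p :=
  GRing.isSubringClosed.Build rat (locint p) (p_integral_subring p).

(** The ideal generated by [p^m]; a congruence becomes the membership of a difference. *)
Definition pideal (p m : nat) : {pred rat} :=
  [pred x | x / p%:R ^+ m \in locint p].

Lemma pideal_zmod p m : zmod_closed (pideal p m).
Proof.
split=> [|x y]; first by rewrite inE mul0r rpred0.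
by rewrite !inE mulrBl; apply: rpredB.
Qed.

HB.instance Definition _ p m :=
  GRing.isZmodClosed.Build rat (pideal p m) (pideal_zmod p m).

Section Ideals.
Variable p : nat.
Hypothesis p_prime : prime p.

Let p_gt0 : (0 < p)%N. Proof. exact: prime_gt0. Qed.
Let p_neq0 : p%:R != 0 :> rat. Proof. by rewrite pnatr_eq0 -lt0n. Qed.

Lemma pidealZ c x m :
  c \in locint p -> x \in pideal p m -> c * x \in pideal p m.
Proof. by move=> cL; rewrite !inE -mulrA; apply: rpredM. Qed.

Lemma pideal0 x : (x \in pideal p 0) = (x \in locint p).
Proof. by rewrite inE expr0 divr1. Qed.

Lemma pidealX x k m :
  (p%:R ^+ k * x \in pideal p (k + m)) = (x \in pideal p m).
Proof. by rewrite !inE exprD invfM mulrACA divff ?mul1r ?expf_neq0. Qed.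

Lemma pidealXW x k : x \in locint p -> p%:R ^+ k * x \in pideal p k.
Proof. by move=> xL; rewrite -[k in pideal _ k]addn0 pidealX pideal0. Qed.

Lemma pidealM x y k m :
  x \in pideal p k -> y \in pideal p m -> x * y \in pideal p (k + m).
Proof. by rewrite !inE exprD invfM => xk ym; rewrite mulrACA rpredM. Qed.

Lemma pideal_le k m x : (k <= m)%N -> x \in pideal p m -> x \in pideal p k.
Proof.
move=> /subnK <-; rewrite !inE exprD => xm.
rewrite (_ : x / _ = p%:R ^+ (m - k) * (x / (p%:R ^+ (m - k) * p%:R ^+ k))).
  by rewrite rpredM ?rpredX ?rpred_nat.
by field; rewrite !expf_neq0.
Qed.

Lemma pideal_locint m x : x \in pideal p m -> x \in locint p.
Proof. by rewrite -pideal0; apply: pideal_le. Qed.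

Lemma locint_inv k : (0 < k < p)%N -> k%:R^-1 \in locint p.
Proof.
case/andP=> k_gt0 kp; apply/p_integralP; exists k.
  by rewrite coprime_sym prime_coprime // gtnNdvd.
by rewrite k_gt0 mulVf ?pnatr_eq0 -?lt0n //.
Qed.

Lemma pideal_sum m (a b : nat) (F : nat -> rat) :
  (forall k, (a <= k < b)%N -> F k \in pideal p m) ->
  \sum_(a <= k < b) F k \in pideal p m.
Proof. by move=> FI; rewrite big_nat; apply: rpred_sum => k; apply: FI. Qed.

Lemma locint_sum (a b : nat) (F : nat -> rat) :
  (forall k, (a <= k < b)%N -> F k \in locint p) ->
  \sum_(a <= k < b) F k \in locint p.
Proof. by move=> FI; rewrite big_nat; apply: rpred_sum => k; apply: FI. Qed.

Lemma pideal_sumB m (a b : nat) (F G : nat -> rat) :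
  (forall k, (a <= k < b)%N -> F k - G k \in pideal p m) ->
  \sum_(a <= k < b) F k - \sum_(a <= k < b) G k \in pideal p m.
Proof. by rewrite -sumrB; apply: pideal_sum. Qed.

Lemma fermat_pideal (k : nat) :
  (0 < k < p)%N -> k%:R ^+ p.-1 - 1 \in pideal p 1.
Proof.
move=> kp; have k_gt0 : (0 < k)%N by case/andP: kp.
have le : (k <= k ^ p)%N.
  by rewrite -[X in (X <= _)%N]expn1 leq_pexp2l.
have /dvdnP[c e] : (p %| k ^ p - k)%N.
  by rewrite -eqn_mod_dvd //; apply/eqP; apply: fermat_little.
rewrite (_ : _ - 1 = k%:R^-1 * (p%:R ^+ 1 * c%:R)).
  by rewrite pidealZ ?locint_inv ?pidealXW ?rpred_nat.
have k0 : k%:R != 0 :> rat by rewrite pnatr_eq0 -lt0n.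
rewrite expr1 mulrC -natrM mulnC -e natrB // natrX.
by rewrite -[in RHS](prednK p_gt0) exprS; field.
Qed.

End Ideals.

Ltac lint :=
  repeat match goal with
  | H : is_true ?x |- is_true ?x => exact: H
  | |- is_true (_ + _ \in _) => apply: rpredD
  | |- is_true (- _ \in _) => rewrite rpredN
  | |- is_true (_ * _ \in _) => apply: rpredM
  | |- is_true (_ ^+ _ \in _) => apply: rpredX
  | |- is_true (_ *+ _ \in _) => apply: rpredMn
  | |- is_true (1 \in _) => exact: rpred1
  | |- is_true (0 \in _) => exact: rpred0
  | |- is_true (_^-1 \in _) => apply: locint_inv => //; lia
  end.

(** * Two splittings of an index range, for sums and for products alike *)

Section Splitting.
Variables (R : Type) (idx : R) (op : Monoid.com_law idx).
Implicit Types (F : nat -> R) (a b n : nat).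

Lemma big_nat_flip a b F :
  \big[op/idx]_(1 <= k < (a + b).+1) F k =
  op (\big[op/idx]_(1 <= k < a.+1) F k)
     (\big[op/idx]_(1 <= k < b.+1) F ((a + b).+1 - k)%N).
Proof.
elim: b => [|b IHb]; first by rewrite addn0 [X in op _ X]big_geq ?Monoid.mulm1.
rewrite addnS big_nat_recr // IHb [X in _ = op _ X]big_nat_recl //=.
rewrite -Monoid.mulmA.
by congr (op _ _); rewrite [LHS]Monoid.mulmC subn1; congr (op _ _).
Qed.

Lemma big_nat_halves n F :
  \big[op/idx]_(1 <= k < n.*2.+1) F k =
  op (\big[op/idx]_(1 <= k < n.+1) F k)
     (\big[op/idx]_(1 <= k < n.+1) F (n.*2.+1 - k)%N).
Proof. by rewrite -addnn big_nat_flip. Qed.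

Lemma big_nat_parity n F :
  \big[op/idx]_(1 <= k < n.*2.+1) F k =
  op (\big[op/idx]_(1 <= k < n.+1) F k.*2)
     (\big[op/idx]_(1 <= k < n.+1) F (n.*2.+1 - k.*2)%N).
Proof.
(* The odd indices are first listed as [2k - 1]; reversing their order gives [2n + 1 - 2k]. *)
have -> : \big[op/idx]_(1 <= k < n.*2.+1) F k =
    op (\big[op/idx]_(1 <= k < n.+1) F k.*2)
       (\big[op/idx]_(1 <= k < n.+1) F k.*2.-1).
  elim: n => [|n IHn]; first by rewrite !big_geq ?Monoid.mulm1.
  rewrite doubleS (big_nat_recr n.*2.+2) // (big_nat_recr n.*2.+1) //.
  rewrite !(big_nat_recr n.+1) //= IHn.
  rewrite -!Monoid.mulmA; congr (op _ _); rewrite [RHS]Monoid.mulmCA.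
  by congr (op _ _); rewrite [LHS]Monoid.mulmC.
congr (op _ _); rewrite big_nat_rev; apply: eq_big_nat => k kn.
by congr F; lia.
Qed.

End Splitting.

(* The upper bound is strict: [harm s m] is [H_(m-1)^(s)]. *)
Definition harm (s m : nat) : rat := \sum_(1 <= k < m) k%:R^-1 ^+ s.

Lemma harmS s m : (0 < m)%N -> harm s m.+1 = harm s m + m%:R^-1 ^+ s.
Proof. by move=> m_gt0; rewrite /harm big_nat_recr. Qed.

Lemma harm1 s : harm s 1 = 0.
Proof. by rewrite /harm big_geq. Qed.

(** * Nested harmonic sums and symmetric functions of reciprocals *)

(** The double sum of [1/(j r^2)] over [1 <= j < r < m], as [harm 1 r] stops before [r]. *)
Definition nested (m : nat) : rat := \sum_(1 <= r < m) harm 1 r * r%:R^-1 ^+ 2.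

(** Since [harm 1 k.+1] includes [1/k], this is the complete homogeneous symmetric function of
    degree 2, written in power sums. *)
Lemma sum_harm1 m : (0 < m)%N ->
  \sum_(1 <= k < m) harm 1 k.+1 * k%:R^-1 = (harm 1 m ^+ 2 + harm 2 m) / 2%:R.
Proof.
elim: m => // -[|m] IHm _; first by rewrite big_geq // !harm1; ring.
rewrite big_nat_recr //= IHm // !(harmS _ m.+1) // expr1.
by move: m.+1%:R^-1 => x; field.
Qed.

(** The quotient on the left is the second elementary symmetric function of [1, ..., 1/k].
    Multiplied by [1/k] it runs over triples [i < j <= k]: those with [j < k] give the third
    elementary symmetric function, in Newton's form, and those with [j = k] give [nested m]. *)
Lemma sum_elem2 m : (0 < m)%N ->
  \sum_(1 <= k < m) (harm 1 k.+1 ^+ 2 - harm 2 k.+1) / 2%:R * k%:R^-1 =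
  (harm 1 m ^+ 3 - 3%:R * harm 1 m * harm 2 m + 2%:R * harm 3 m) / 6%:R +
  nested m.
Proof.
rewrite /nested; elim: m => // -[|m] IHm _.
  by rewrite !big_geq // !harm1; ring.
rewrite !(big_nat_recr m.+1) //= IHm // !(harmS _ m.+1) // expr1.
by move: m.+1%:R^-1 => x; field.
Qed.

Lemma pideal_eq {p m x y} : x \in pideal p m -> y = x -> y \in pideal p m.
Proof. by move=> xI ->. Qed.

Lemma natr_neq0 k : (0 < k)%N -> k%:R != 0 :> rat.
Proof. by rewrite pnatr_eq0 lt0n. Qed.

Lemma inv_double k s : k.*2%:R^-1 ^+ s = 2%:R^-1 ^+ s * k%:R^-1 ^+ s :> rat.
Proof. by rewrite -exprMn -mul2n natrM invfM. Qed.

(** * Faulhaber's formula for sums of powers *)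

Lemma mul_bin_swap n i j : (i + j <= n)%N ->
  ('C(n, j) * 'C(n - j, i) = 'C(n, i) * 'C(n - i, j))%N.
Proof.
move=> le; apply/eqP.
rewrite -(@eqn_pmul2r (i`! * j`! * (n - i - j)`!)) ?muln_gt0 ?fact_gt0 //.
have A : ('C(n, j) * (j`! * (n - j)`!) = n`!)%N by apply: bin_fact; lia.
have B : ('C(n - j, i) * (i`! * (n - j - i)`!) = (n - j)`!)%N.
  by apply: bin_fact; lia.
have C : ('C(n, i) * (i`! * (n - i)`!) = n`!)%N by apply: bin_fact; lia.
have D : ('C(n - i, j) * (j`! * (n - i - j)`!) = (n - i)`!)%N.
  by apply: bin_fact; lia.
rewrite subnAC in B.
apply/eqP; transitivity n`!; [rewrite -A -B | rewrite -C -D]; ring.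
Qed.

(** The top power cancels. The range of [i] is kept independent of [j], so that [faulhaber_step] can
    exchange two sums. *)
Lemma exprD1_trunc (x : rat) m j : (j <= m)%N ->
  (x + 1) ^+ (m.+1 - j) - x ^+ (m.+1 - j) =
  \sum_(i < m.+1 | (i + j < m.+1)%N) 'C(m.+1 - j, i)%:R * x ^+ i.
Proof.
move=> jm; have -> : (m.+1 - j)%N = (m - j).+1 by rewrite subSn.
rewrite [x + 1]addrC exprDn big_ord_recr /= binn mulr1n expr1n mul1r addrK.
rewrite (big_ord_widen m.+1
  (fun i => 1 ^+ ((m - j).+1 - i) * x ^+ i *+ 'C((m - j).+1, i))); last by lia.
apply: eq_big => [i|i _]; first by lia.
by rewrite expr1n mul1r mulr_natl.
Qed.

(** After the exchange, the coefficient of [x^i] is ['C(m.+1, i)] times the recurrence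
    [bernoulli_rec] of order [m - i], so only [i = m] survives. *)
Lemma faulhaber_step (x : rat) m :
  \sum_(j < m.+1) 'C(m.+1, j)%:R * bernoulli j *
     ((x + 1) ^+ (m.+1 - j) - x ^+ (m.+1 - j)) = m.+1%:R * x ^+ m.
Proof.
under eq_bigr => j _ do
  rewrite (exprD1_trunc _ _ _ (leq_ord j)) mulr_sumr big_mkcond.
rewrite exchange_big /=.
transitivity (\sum_(i < m.+1) 'C(m.+1, i)%:R * x ^+ i * ((m - i)%N == 0%N)%:R).
  apply: eq_bigr => i _; rewrite -bernoulli_rec.
  rewrite (big_ord_widen m.+1 (fun k => 'C((m - i).+1, k)%:R * bernoulli k));
    last by lia.
  rewrite mulr_sumr [RHS]big_mkcond; apply: eq_bigr => j _.
  rewrite -subSn ?leq_ord // [(j < _)%N](_ : _ = (i + j < m.+1)%N); last by lia.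
  case: ifP => // ij.
  have e : 'C(m.+1, j)%:R * 'C(m.+1 - j, i)%:R =
      'C(m.+1, i)%:R * 'C(m.+1 - i, j)%:R :> rat.
    by rewrite -!natrM mul_bin_swap //; lia.
  transitivity ('C(m.+1, j)%:R * 'C(m.+1 - j, i)%:R * bernoulli j * x ^+ i).
    by ring.
  by rewrite e; ring.
rewrite big_ord_recr /= subnn eqxx mulr1 binSn big1 ?add0r // => i _.
by rewrite subn_eq0 leqNgt ltn_ord mulr0.
Qed.

Lemma faulhaber m N :
  m.+1%:R * \sum_(0 <= x < N) x%:R ^+ m =
  \sum_(j < m.+1) 'C(m.+1, j)%:R * bernoulli j * N%:R ^+ (m.+1 - j).
Proof.
elim: N => [|N IHN].
  rewrite big_geq // mulr0 big1 // => j _.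
  by rewrite expr0n subn_eq0 leqNgt ltn_ord mulr0.
rewrite big_nat_recr //= mulrDr IHN -(faulhaber_step N%:R) -big_split /=.
by apply: eq_bigr => j _; rewrite -natr1; ring.
Qed.

(** * Generalized binomial coefficients and their weighted alternating sum *)

Lemma gbinom0 a : gbinom a 0 = 1.
Proof. by rewrite /gbinom big_ord0 fact0 divr1. Qed.

Lemma natrS_neq0 k : k.+1%:R != 0 :> rat.
Proof. by rewrite pnatr_eq0. Qed.

Lemma gbinomS a k : k.+1%:R * gbinom a k.+1 = (a - k%:R) * gbinom a k.
Proof.
have k0 : k`!%:R != 0 :> rat by rewrite pnatr_eq0 -lt0n fact_gt0.
rewrite /gbinom big_ord_recr /= factS natrM invfM mulrCA mulVKf ?natrS_neq0 //.
by rewrite mulrCA mulrA.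
Qed.

Lemma gbinom_shift a k : k.+1%:R * gbinom a k.+1 = a * gbinom (a - 1) k.
Proof.
rewrite /gbinom big_ord_recl /= factS natrM invfM subr0.
rewrite mulrCA mulVKf ?natrS_neq0 // mulrA.
congr (_ * _ / _); apply: eq_bigr => i _.
by rewrite /bump /= add1n -natr1; ring.
Qed.

Lemma gbinom_ratio a k : (a - k%:R) * gbinom a k = a * gbinom (a - 1) k.
Proof. by rewrite -gbinomS gbinom_shift. Qed.

Lemma gbinom_pascal a k :
  gbinom a k.+1 = gbinom (a - 1) k.+1 + gbinom (a - 1) k.
Proof.
apply: (mulfI (natrS_neq0 k)).
by rewrite gbinom_shift mulrDr gbinomS -natr1; ring.
Qed.

Lemma gbinom_nat (m k : nat) : gbinom m%:R k = 'C(m, k)%:R.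
Proof.
elim: k => [|k IHk]; first by rewrite gbinom0 bin0.
apply: (mulfI (natrS_neq0 k)); rewrite gbinomS IHk -natrM mul_bin_left natrM.
have [km|mk] := leqP k m; first by rewrite natrB.
by rewrite bin_small // !mulr0.
Qed.

Lemma gbinomN1 k : gbinom (-1) k = (-1) ^+ k.
Proof.
elim: k => [|k IHk]; first by rewrite gbinom0.
by apply: (mulfI (natrS_neq0 k)); rewrite gbinomS IHk exprS -natr1; ring.
Qed.

Lemma gbinom_altsum a m :
  \sum_(0 <= k < m.+1) (-1) ^+ k * gbinom a k = (-1) ^+ m * gbinom (a - 1) m.
Proof.
elim: m => [|m IHm]; first by rewrite big_nat1 !gbinom0.
by rewrite big_nat_recr //= IHm (gbinom_pascal a) exprS; ring.
Qed.

(** [bsum p] is the [f] of the opening outline; the bound stays variable for the induction in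
    [quadmod_bsum]. *)
Definition bsum (m : nat) (a : rat) : rat :=
  \sum_(1 <= k < m) (-1) ^+ k / k%:R * gbinom a k.

(** By Pascal's rule and [gbinom_shift] the [k]-th term on the left is [(-1)^k gbinom a k]; what
    remains is [gbinom_altsum] without its term at [k = 0]. *)
Lemma bsum_diff m a :
  a * (bsum m.+1 a - bsum m.+1 (a - 1)) = (-1) ^+ m * gbinom (a - 1) m - 1.
Proof.
rewrite -gbinom_altsum big_ltn // gbinom0 expr0 mul1r addrAC subrr add0r.
rewrite -sumrB mulr_sumr; apply: eq_big_nat => -[|k] // _.
rewrite -mulrBr [X in X - _]gbinom_pascal addrAC subrr add0r.
by rewrite mulrCA -gbinom_shift mulrA divfK ?natrS_neq0.
Qed.

(** * Expansion of [1/(p - k)] in powers of [p] *)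

Section Congruences.
Variable p : nat.
Hypotheses (p_prime : prime p) (p_gt3 : (3 < p)%N).
Local Notation P := (p%:R : rat).
Local Notation G s := (harm s p).

Let p_neq0 : P != 0. Proof. by rewrite pnatr_eq0; lia. Qed.

Lemma natr_flip k : (0 < k < p)%N ->
  ((p - k)%:R = p%:R - k%:R :> rat) * (k%:R != 0 :> rat) *
  (p%:R - k%:R != 0 :> rat).
Proof.
move=> kp; have e : (p - k)%:R = p%:R - k%:R :> rat by rewrite natrB //; lia.
by rewrite -e !pnatr_eq0; split=> //; [split=> //|]; lia.
Qed.

Lemma locint_harm s m : (m <= p)%N -> harm s m \in locint p.
Proof. by move=> mp; apply: locint_sum => k km; lint. Qed.

(** Carries termwise expansions over to sums; every expansion it serves stops at the cubic term. *)
Lemma harm_approx m e (F : nat -> rat) (a b c : rat) :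
  (forall k, (1 <= k < m)%N ->
    F k - (a * k%:R^-1 ^+ 1 + b * k%:R^-1 ^+ 2 + c * k%:R^-1 ^+ 3)
      \in pideal p e) ->
  \sum_(1 <= k < m) F k - (a * harm 1 m + b * harm 2 m + c * harm 3 m)
    \in pideal p e.
Proof.
by move=> FI; rewrite /harm !mulr_sumr -!big_split; apply: pideal_sumB.
Qed.

(** The geometric series of [-(1/k) / (1 - p/k)], cut after three terms; the next two lemmas do the
    same for its square and cube. *)
Lemma inv_flip1 k : (0 < k < p)%N ->
  (p - k)%:R^-1 + (k%:R^-1 + p%:R * k%:R^-1 ^+ 2 + p%:R ^+ 2 * k%:R^-1 ^+ 3)
    \in pideal p 3.
Proof.
move=> kp; have [[e k0] pk0] := natr_flip k kp.
rewrite (_ : _ + _ = p%:R ^+ 3 * (k%:R^-1 ^+ 3 * (p - k)%:R^-1)).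
  by apply: pidealXW => //; lint.
by rewrite e; field; rewrite ?k0 ?pk0.
Qed.

Lemma inv_flip2 k : (0 < k < p)%N ->
  (p - k)%:R^-1 ^+ 2 - (k%:R^-1 ^+ 2 + 2%:R * p%:R * k%:R^-1 ^+ 3)
    \in pideal p 2.
Proof.
move=> kp; have [[e k0] pk0] := natr_flip k kp.
rewrite (_ : _ - _ = p%:R ^+ 2 *
  (3%:R * k%:R^-1 ^+ 2 * (p - k)%:R^-1 ^+ 2 -
   2%:R * p%:R * k%:R^-1 ^+ 3 * (p - k)%:R^-1 ^+ 2)).
  by apply: pidealXW => //; lint.
by rewrite e; field; rewrite ?k0 ?pk0.
Qed.

Lemma inv_flip3 k : (0 < k < p)%N ->
  (p - k)%:R^-1 ^+ 3 + k%:R^-1 ^+ 3 \in pideal p 1.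
Proof.
move=> kp; have [[e k0] pk0] := natr_flip k kp.
rewrite (_ : _ + _ = p%:R ^+ 1 * (
  (p%:R ^+ 2 * k%:R^-1 ^+ 3 - 3%:R * p%:R * k%:R^-1 ^+ 2 + 3%:R * k%:R^-1)
  * (p - k)%:R^-1 ^+ 3)).
  by apply: pidealXW => //; lint.
by rewrite e; field; rewrite ?k0 ?pk0.
Qed.

Lemma pideal_half m x : 2%:R * x \in pideal p m -> x \in pideal p m.
Proof.
move=> xI; rewrite (_ : x = 2%:R^-1 * (2%:R * x)); last by field.
by apply: pidealZ => //; lint.
Qed.

Lemma pideal_third m x : 3%:R * x \in pideal p m -> x \in pideal p m.
Proof.
move=> xI; rewrite (_ : x = 3%:R^-1 * (3%:R * x)); last by field.
by apply: pidealZ => //; lint.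
Qed.

Lemma predp_natr : p.-1%:R = P - 1.
Proof. by rewrite -[in RHS](prednK (prime_gt0 p_prime)) -natr1 addrK. Qed.

(** * Bernoulli numbers and power sums modulo [p^2] *)

(** A weak form of von Staudt's theorem: up to index [p - 2] the recurrence divides only by integers
    below [p]. *)
Lemma locint_bernoulli j : (j.+1 < p)%N -> bernoulli j \in locint p.
Proof.
elim/ltn_ind: j => j IHj jp.
have := bernoulli_rec j; rewrite big_ord_recr /= binSn => e.
have -> : bernoulli j = j.+1%:R^-1 * ((j == 0%N)%:R -
    \sum_(k < j) 'C(j.+1, k)%:R * bernoulli k).
  by rewrite -e addrAC subrr add0r mulKf // pnatr_eq0.
apply: rpredM; first by lint.
apply: rpredB; first exact: rpred_nat.
apply: rpred_sum => k _; apply: rpredM; first exact: rpred_nat.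
by apply: IHj => //; have := ltn_ord k; lia.
Qed.

(** In Faulhaber's formula for the exponent [p - 3], the last term is [(p - 2) p B_(p-3)] and all
    others contain [p^2]. *)
Lemma powersum_bernoulli :
  \sum_(1 <= k < p) k%:R ^+ (p - 3) - P * bernoulli (p - 3) \in pideal p 2.
Proof.
have [m mE] : exists m, p = m.+4 by exists (p - 4)%N; lia.
have -> : (p - 3)%N = m.+1 by lia.
have B := faulhaber m.+1 p.
rewrite big_ord_recr /= binSn subSnn expr1 in B.
have -> : \sum_(1 <= k < p) k%:R ^+ m.+1 =
    \sum_(0 <= k < p) k%:R ^+ m.+1 :> rat.
  by rewrite [in RHS]big_ltn ?expr0n ?add0r // prime_gt0.
set T := \sum_(0 <= _ < _) _ in B *.
set s := \sum_(_ < _) _ in B.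
rewrite (_ : _ - _ = m.+2%:R^-1 * s); last first.
  have m0 : m.+2%:R != 0 :> rat by rewrite pnatr_eq0.
  rewrite (_ : s = m.+2%:R * T - m.+2%:R * bernoulli m.+1 * P); last first.
    by rewrite B; ring.
  by rewrite -mulrA -mulrBr mulKf // [P * _]mulrC.
apply: pidealZ => //; first by lint.
apply: rpred_sum => j _; apply: pidealZ => //.
  apply: rpredM; first exact: rpred_nat.
  by apply: locint_bernoulli; have := ltn_ord j; lia.
rewrite -[_ ^+ _]mulr1; apply: (@pideal_le p p_prime _ (m.+2 - j)).
  by have := ltn_ord j; lia.
by apply: pidealXW => //; lint.
Qed.

Lemma expr_shift_mod (y : rat) m : y \in locint p ->
  (P + y) ^+ m.+1 - (y ^+ m.+1 + m.+1%:R * P * y ^+ m) \in pideal p 2.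
Proof.
move=> yL; elim: m => [|m IHm].
  by rewrite (_ : _ - _ = 0) ?rpred0 // !expr1 expr0; ring.
rewrite (_ : _ - _ =
  (P + y) * ((P + y) ^+ m.+1 - (y ^+ m.+1 + m.+1%:R * P * y ^+ m))
  + P ^+ 2 * (m.+1%:R * y ^+ m)).
  by apply: rpredD; [apply: pidealZ => //; lint | apply: pidealXW => //; lint].
rewrite -[m.+2%:R]natr1 !exprS; ring.
Qed.

(* [log (1 + p c) / p] up to a multiple of [p^3]. *)
Definition tlog (c : rat) : rat :=
  c - P * c ^+ 2 / 2%:R + P ^+ 2 * c ^+ 3 / 3%:R.

(** * Additivity of the truncated logarithm *)

Lemma tlog0 : tlog 0 = 0.
Proof. by rewrite /tlog; ring. Qed.

(** The argument [a + b + p a b] is the [c] with [1 + p c = (1 + p a)(1 + p b)]. *)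
Lemma tlogD a b : a \in locint p -> b \in locint p ->
  tlog (a + b + P * a * b) - (tlog a + tlog b) \in pideal p 3.
Proof.
move=> aL bL.
rewrite (_ : _ - _ = P ^+ 3 * ((a + b) ^+ 2 * a * b - (a * b) ^+ 2 / 2%:R +
   P * (a + b) * (a * b) ^+ 2 + P ^+ 2 * (a * b) ^+ 3 / 3%:R)).
  by apply: pidealXW => //; lint.
by rewrite /tlog; field.
Qed.

Lemma tlog_prod m (a : nat -> rat) :
  (forall k, (1 <= k < m)%N -> a k \in locint p) ->
  exists c, [/\ c \in locint p, \prod_(1 <= k < m) (1 + P * a k) = 1 + P * c
    & tlog c - \sum_(1 <= k < m) tlog (a k) \in pideal p 3].
Proof.
elim: m => [|[|m] IHm] aL; try by
  exists 0; rewrite !big_geq // mulr0 addr0 tlog0 subr0 !rpred0.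
move: m.+1 (ltn0Sn m) IHm aL => {}m m_gt0 IHm aL.
have [|c [cL ec lc]] := IHm; first by move=> k km; apply: aL; lia.
have mL : a m \in locint p by apply: aL; lia.
exists (c + a m + P * c * a m); split; first by lint.
  by rewrite big_nat_recr //= ec; ring.
rewrite big_nat_recr //=.
rewrite (_ : _ - _ = (tlog (c + a m + P * c * a m) - (tlog c + tlog (a m))) +
  (tlog c - \sum_(1 <= k < m) tlog (a k))); last by ring.
by rewrite rpredD ?tlogD.
Qed.

Lemma locint_inv_shift r : (0 < r < p)%N -> (P + r%:R)^-1 \in locint p.
Proof.
move=> rp; apply/p_integralP; exists (p + r)%N.
  by rewrite coprime_sym prime_coprime // dvdn_addr // gtnNdvd; lia.
by rewrite natrD mulVf ?int_num1 ?andbT -?natrD ?pnatr_eq0; lia.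
Qed.

(** * Functions that are quadratic modulo [p^3] *)

(** Each power of [t] carries the same power of [p]; hence the class is closed under products, whose
    terms in [t^3] and [t^4] vanish modulo [p^3]. *)
Definition quadmod (F : rat -> rat) : Prop :=
  exists A B C, [/\ A \in locint p, B \in locint p, C \in locint p &
    forall t, t \in locint p ->
      F t - (A + B * P * t + C * P ^+ 2 * t ^+ 2) \in pideal p 3].

Lemma quadmod_lin x y : x \in locint p -> y \in locint p ->
  quadmod (fun t => x + y * P * t).
Proof.
move=> xL yL; exists x, y, 0; split=> // [|t _]; first exact: rpred0.
by rewrite (_ : _ - _ = 0) ?rpred0 //; ring.
Qed.

Lemma quadmod_cst x : x \in locint p -> quadmod (fun=> x).
Proof.
move=> xL; exists x, 0, 0; split=> // [||t _]; try exact: rpred0.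
by rewrite (_ : _ - _ = 0) ?rpred0 //; ring.
Qed.

Lemma quadmodD F1 F2 :
  quadmod F1 -> quadmod F2 -> quadmod (fun t => F1 t + F2 t).
Proof.
case=> A1 [B1 [C1 [A1L B1L C1L H1]]] [A2 [B2 [C2 [A2L B2L C2L H2]]]].
exists (A1 + A2), (B1 + B2), (C1 + C2); split; try by lint.
move=> t tL; apply: (pideal_eq (rpredD (H1 t tL) (H2 t tL))); ring.
Qed.

Lemma quadmodM F1 F2 :
  quadmod F1 -> quadmod F2 -> quadmod (fun t => F1 t * F2 t).
Proof.
case=> A1 [B1 [C1 [A1L B1L C1L H1]]] [A2 [B2 [C2 [A2L B2L C2L H2]]]].
exists (A1 * A2), (A1 * B2 + B1 * A2), (A1 * C2 + B1 * B2 + C1 * A2).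
split; try by lint.
move=> t tL; move: (H1 t tL) (H2 t tL).
set Q1 := A1 + _ + _; set Q2 := A2 + _ + _ => D1 D2.
have Q1L : Q1 \in locint p by rewrite /Q1; lint.
have Q2L : Q2 \in locint p by rewrite /Q2; lint.
have F1L : F1 t \in locint p.
  by rewrite -[F1 t](subrK Q1) rpredD // (pideal_locint _ p_prime _ _ D1).
rewrite (_ : _ - _ = F1 t * (F2 t - Q2) + Q2 * (F1 t - Q1) +
   P ^+ 3 * ((B1 * C2 + B2 * C1) * t ^+ 3 + P * C1 * C2 * t ^+ 4)).
  apply: rpredD; first by apply: rpredD; apply: pidealZ.
  by apply: pidealXW => //; lint.
by rewrite /Q1 /Q2; ring.
Qed.

Lemma quadmod_ext F1 F2 : F1 =1 F2 -> quadmod F1 -> quadmod F2.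
Proof.
move=> e [A [B [C [AL BL CL H]]]]; exists A, B, C; split=> // t tL.
by rewrite -e H.
Qed.

(** Each factor [x + p t - i] is linear in [p t], and the divisors [1, ..., k] are prime to [p]. *)
Lemma quadmod_gbinom x k : x \in locint p -> (k < p)%N ->
  quadmod (fun t => gbinom (x + P * t) k).
Proof.
move=> xL; elim: k => [|k IHk] kp.
  by apply: quadmod_ext (quadmod_cst 1 (rpred1 _)) => t; rewrite gbinom0.
apply: quadmod_ext (quadmodM (fun=> k.+1%:R^-1) _ _
  (quadmodM (fun t => (x - k%:R) + 1 * P * t) _ _ (IHk (ltnW kp)))).
- move=> t /=; apply: (mulfI (natrS_neq0 k)).
  by rewrite gbinomS mulVKf ?natrS_neq0 //; ring.
- by apply: quadmod_cst; lint.
- by apply: quadmod_lin => //; lint; exact: rpred_nat.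
Qed.

Lemma quadmod_bsum x m : x \in locint p -> (m <= p)%N ->
  quadmod (fun t => bsum m (x + P * t)).
Proof.
move=> xL; elim: m => [|[|m] IHm] mp; try by
  apply: quadmod_ext (quadmod_cst 0 (rpred0 _)) => t; rewrite /bsum big_geq.
have cL : (-1) ^+ m.+1 / m.+1%:R \in locint p by lint.
apply: quadmod_ext (quadmodD _ _ (IHm (ltnW mp))
  (quadmodM _ _ (quadmod_cst _ cL) (quadmod_gbinom x m.+1 xL mp))).
by move=> t /=; rewrite /bsum [in RHS]big_nat_recr.
Qed.

(* Lagrange interpolation at [-1/2] from the nodes [-1], [0], [1]. *)
Lemma quadmod_interp F : quadmod F ->
  8%:R * F (- 2%:R^-1) - (6%:R * F 0 + 3%:R * F (-1) - F 1) \in pideal p 3.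
Proof.
have two : 2%:R^-1 \in locint p by lint.
case=> A [B [C [AL BL CL H]]].
have [H1 H2 H3 H4] := And4 (H (- 2%:R^-1) ltac:(lint)) (H 0 ltac:(lint))
  (H (-1) ltac:(lint)) (H 1 ltac:(lint)).
have K (c : nat) z : z \in pideal p 3 -> c%:R * z \in pideal p 3.
  by move=> zI; rewrite mulr_natl rpredMn.
apply: (pideal_eq (rpredB (K 8%N _ H1)
  (rpredB (rpredD (K 6%N _ H2) (K 3%N _ H3)) H4))).
by field.
Qed.

(** * Harmonic sums up to [n] and up to [p - 1] *)

Variable n : nat.
Hypothesis pE : p = n.*2.+1.
Local Notation h s := (harm s n.+1).

Lemma sum_flip (F : nat -> rat) :
  \sum_(1 <= k < p) F k = \sum_(1 <= k < p) F (p - k)%N.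
Proof. by rewrite pE -[n.*2]add0n big_nat_flip big_geq //= add0r. Qed.

Lemma harm3_full : G 3 \in pideal p 1.
Proof.
apply: pideal_half.
have : \sum_(1 <= k < p) (p - k)%:R^-1 ^+ 3 - (0 * G 1 + 0 * G 2 + -1 * G 3)
    \in pideal p 1.
  apply: harm_approx => k kp; rewrite !mul0r !add0r mulN1r opprK.
  exact: inv_flip3.
rewrite -(sum_flip (fun k => k%:R^-1 ^+ 3)) -/(harm 3 p).
by rewrite (_ : _ - _ = 2%:R * G 3) //; ring.
Qed.

(** The reflection [k -> p - k] gives [2 G_1 = - p G_2 - p^2 G_3] modulo [p^3], and [G_3] vanishes
    modulo [p]. *)
Lemma harm1_full : G 1 + P * G 2 / 2%:R \in pideal p 3.
Proof.
apply: pideal_half.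
have : \sum_(1 <= k < p) (p - k)%:R^-1 ^+ 1 -
   (-1 * G 1 + - P * G 2 + (- P ^+ 2) * G 3) \in pideal p 3.
  apply: harm_approx => k kp; apply: (pideal_eq (inv_flip1 k kp)).
  by rewrite !expr1; ring.
rewrite -(sum_flip (fun k => k%:R^-1 ^+ 1)) -/(harm 1 p) => A.
have B : P ^+ 2 * G 3 \in pideal p 3.
  by rewrite (pidealX _ p_prime _ 2 1) harm3_full.
rewrite (_ : _ * _ = (G 1 - (-1 * G 1 + - P * G 2 + (- P ^+ 2) * G 3)) -
  P ^+ 2 * G 3); last by field.
exact: rpredB.
Qed.

Lemma harm2_halves : G 2 - (2%:R * h 2 + 2%:R * P * h 3) \in pideal p 2.
Proof.
have A : \sum_(1 <= k < n.+1) (p - k)%:R^-1 ^+ 2 -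
   (0 * h 1 + 1 * h 2 + 2%:R * P * h 3) \in pideal p 2.
  apply: harm_approx => k kp; rewrite mul0r add0r mul1r; apply: inv_flip2; lia.
have -> : G 2 = h 2 + \sum_(1 <= k < n.+1) (p - k)%:R^-1 ^+ 2.
  by rewrite /harm {1}pE big_nat_halves pE.
by rewrite (_ : _ - _ = (\sum_(1 <= k < n.+1) (p - k)%:R^-1 ^+ 2 -
   (0 * h 1 + 1 * h 2 + 2%:R * P * h 3))) //; ring.
Qed.

Lemma harm2_parity : G 2 - (h 2 / 2%:R + P * h 3 / 4%:R) \in pideal p 2.
Proof.
have A : \sum_(1 <= k < n.+1) (p - k.*2)%:R^-1 ^+ 2 -
   (0 * h 1 + 4%:R^-1 * h 2 + P / 4%:R * h 3) \in pideal p 2.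
  apply: harm_approx => k kp.
  have := inv_flip2 k.*2; rewrite !inv_double => /(_ ltac:(lia)) /pideal_eq.
  by apply; field; rewrite !natr_neq0 //; lia.
have -> : G 2 = h 2 / 4%:R + \sum_(1 <= k < n.+1) (p - k.*2)%:R^-1 ^+ 2.
  rewrite /harm {1}pE big_nat_parity pE mulr_suml; congr (_ + _).
  by apply: eq_bigr => k _; rewrite inv_double mulrC; congr (_ * _); field.
rewrite (_ : _ - _ = (\sum_(1 <= k < n.+1) (p - k.*2)%:R^-1 ^+ 2 -
   (0 * h 1 + 4%:R^-1 * h 2 + P / 4%:R * h 3))) //; by field.
Qed.

(** Eliminates [G 2] between the two splittings: four times the difference of its two values is
    [6 h_2 + 7 p h_3]. The 6 is removed as 2 and 3, because it may exceed [p]. *)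
Lemma harm2_half : h 2 + 7%:R / 6%:R * P * h 3 \in pideal p 2.
Proof.
apply: pideal_half; apply: pideal_third.
rewrite (_ : _ * _ = 4%:R * ((G 2 - (h 2 / 2%:R + P * h 3 / 4%:R))
  - (G 2 - (2%:R * h 2 + 2%:R * P * h 3)))); last by field.
apply: pidealZ; first by lint.
by apply: rpredB; [exact: harm2_parity | exact: harm2_halves].
Qed.

Lemma harm2_fullE : G 2 + P * h 3 / 3%:R \in pideal p 2.
Proof.
rewrite (_ : _ + _ = (G 2 - (2%:R * h 2 + 2%:R * P * h 3)) +
   2%:R * (h 2 + 7%:R / 6%:R * P * h 3)); last by field.
by rewrite rpredD ?harm2_halves ?pidealZ ?harm2_half //; lint.
Qed.

Lemma harm1_fullE : G 1 - P ^+ 2 * h 3 / 6%:R \in pideal p 3.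
Proof.
rewrite (_ : _ - _ = (G 1 + P * G 2 / 2%:R) -
   2%:R^-1 * (P ^+ 1 * (G 2 + P * h 3 / 3%:R))); last by field.
rewrite rpredB ?harm1_full // pidealZ //; first by lint.
by rewrite (pidealX _ p_prime _ 1 2) harm2_fullE.
Qed.

(** * The sum [h_3] and the Bernoulli number modulo [p] *)

Lemma sum_powers_half :
  \sum_(1 <= k < n.+1) k%:R ^+ (p - 4) + 2%:R * bernoulli (p - 3)
    \in pideal p 1.
Proof.
have := powersum_bernoulli.
have [m mE] : exists m, p = m.+4 by exists (p - 4)%N; lia.
have -> : (p - 3)%N = m.+1 by lia.
have -> : (p - 4)%N = m by lia.
(* This fixes the signs of the powers of [-k] in [flip]. *)
have modd : odd m by lia.
set B := bernoulli _; set T := \sum_(_ <= _ < p) _.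
set U := \sum_(_ <= _ < _) _.
pose Tn : rat := \sum_(1 <= k < n.+1) k%:R ^+ m.+1.
have flip k : (k < p)%N ->
    (p - k)%:R ^+ m.+1 - (k%:R ^+ m.+1 - m.+1%:R * P * k%:R ^+ m)
      \in pideal p 2.
  move=> kp; apply: (pideal_eq (expr_shift_mod (- k%:R) m _)).
    by lint.
  rewrite natrB 1?ltnW // (exprNn k%:R m.+1) (exprNn k%:R m).
  rewrite -signr_odd -(signr_odd _ m) /= modd.
  rewrite expr0 expr1; ring.
move=> HB.
have H1 : T - (2%:R * Tn - m.+1%:R * P * U) \in pideal p 2.
  rewrite (_ : T = Tn + \sum_(1 <= k < n.+1) (p - k)%:R ^+ m.+1); last first.
    by rewrite /T {1}pE big_nat_halves pE.
  rewrite (_ : _ - _ = \sum_(1 <= k < n.+1) (p - k)%:R ^+ m.+1 -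
    (Tn - m.+1%:R * P * U)); last by ring.
  rewrite /Tn /U mulr_sumr -sumrB; apply: pideal_sumB => k kn.
  by apply: flip; lia.
have H2 : T - (2%:R * 2%:R ^+ m.+1 * Tn - m.+1%:R * P * 2%:R ^+ m * U)
    \in pideal p 2.
  rewrite (_ : T = 2%:R ^+ m.+1 * Tn +
    \sum_(1 <= k < n.+1) (p - k.*2)%:R ^+ m.+1); last first.
    rewrite /T {1}pE big_nat_parity pE; congr (_ + _).
    by rewrite mulr_sumr; apply: eq_bigr => k _; rewrite -exprMn -natrM mul2n.
  rewrite (_ : _ - _ = \sum_(1 <= k < n.+1) (p - k.*2)%:R ^+ m.+1 -
    (2%:R ^+ m.+1 * Tn - m.+1%:R * P * 2%:R ^+ m * U)); last by ring.
  rewrite /Tn /U !mulr_sumr -sumrB; apply: pideal_sumB => k kn.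
  apply: (pideal_eq (flip k.*2 _)); first by lia.
  by rewrite -mul2n natrM !exprMn; ring.
(* [2^(m+1)] times [H1] minus [H2] cancels [Tn]; a factor [p] then divides out. *)
have H3 : P ^+ 1 * ((2%:R ^+ m.+1 - 1) * B + m.+1%:R * 2%:R ^+ m * U)
    \in pideal p 2.
  rewrite (_ : P ^+ 1 * _ = 2%:R ^+ m.+1 * (T - (2%:R * Tn - m.+1%:R * P * U)) -
    (T - (2%:R * 2%:R ^+ m.+1 * Tn - m.+1%:R * P * 2%:R ^+ m * U))
    - (2%:R ^+ m.+1 - 1) * (T - P * B)); last first.
    by rewrite (exprS 2%:R m); ring.
  apply: rpredB; first apply: rpredB => //.
    by apply: pidealZ => //; lint.
  by apply: pidealZ => //; lint.
rewrite (pidealX _ p_prime _ 1 1) in H3.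
have BL : B \in locint p by apply: locint_bernoulli; lia.
have UL : U \in locint p by apply: locint_sum => k _; lint.
have F2 : 2%:R ^+ p.-1 - 1 \in pideal p 1 by apply: fermat_pideal => //; lia.
apply: pideal_third; rewrite -rpredN.
(* The factor 8 completes [2^m] to [2^(p-1)], which is 1 modulo [p]; as [m + 1 = p - 3], this leaves
   [-3 (U + 2 B)]. *)
rewrite (_ : - _ = 8%:R * ((2%:R ^+ m.+1 - 1) * B + m.+1%:R * 2%:R ^+ m * U)
  - (2%:R * B + m.+1%:R * U) * (2%:R ^+ p.-1 - 1) - P ^+ 1 * U); last first.
  rewrite mE /= (_ : m.+4%:R = m.+1%:R + 3%:R) -?natrD ?addn3 // !exprS.
  by ring.
apply: rpredB; last by apply: pidealXW.
apply: rpredB; first by apply: pidealZ => //; lint.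
by apply: pidealZ => //; lint.
Qed.

(** By Fermat, [1/k^3] and [k^(p-4)] agree modulo [p]. *)
Lemma harm3_bernoulli : harm 3 n.+1 + 2%:R * bernoulli (p - 3) \in pideal p 1.
Proof.
rewrite (_ : _ + _ = (harm 3 n.+1 - \sum_(1 <= k < n.+1) k%:R ^+ (p - 4)) +
  (\sum_(1 <= k < n.+1) k%:R ^+ (p - 4) + 2%:R * bernoulli (p - 3)));
  last by ring.
apply: rpredD; last exact: sum_powers_half.
apply: pideal_sumB => k kn.
have k0 : k%:R != 0 :> rat by rewrite pnatr_eq0; lia.
rewrite (_ : _ - _ = - k%:R^-1 ^+ 3 * (k%:R ^+ p.-1 - 1)).
  by apply: pidealZ; [lint | apply: fermat_pideal => //; lia].
by rewrite (_ : p.-1 = (p - 4) + 3)%N; [rewrite exprD; field | lia].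
Qed.

(** * The Fermat quotient and the second congruence *)

(** Each factor is [2 (p - k) / (p - 2k)]; comparing the two splittings of [(p-1)!] shows that the
    quotients [(p - k) / (p - 2k)] multiply to [2^n]. *)
Lemma prod_odd_pow2 :
  \prod_(1 <= k < n.+1) (1 + P * (p - k.*2)%:R^-1) = 2%:R ^+ p.-1.
Proof.
have H := big_nat_halves _ _ *%R n (fun k => k%:R : rat).
rewrite (big_nat_parity _ _ *%R) /= -pE in H.
have nz (F : nat -> nat) : (forall k, (1 <= k < n.+1)%N -> (0 < F k)%N) ->
    \prod_(1 <= k < n.+1) (F k)%:R != 0 :> rat.
  move=> Fk; rewrite prodf_seq_neq0; apply/allP => k.
  by rewrite mem_index_iota => kn /=; rewrite pnatr_eq0 -lt0n Fk.
have A0 : \prod_(1 <= k < n.+1) k%:R != 0 :> rat by apply: nz => k; lia.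
have B0 : \prod_(1 <= k < n.+1) (p - k.*2)%:R != 0 :> rat.
  by apply: (nz (fun k => p - k.*2)%N) => k; lia.
have e : \prod_(1 <= k < n.+1) (p - k)%:R =
    2%:R ^+ n * \prod_(1 <= k < n.+1) (p - k.*2)%:R :> rat.
  apply: (mulfI A0).
  rewrite -H mulrCA mulrA; congr (_ * _).
  rewrite -[n in _ ^+ n](subn0 n) -subSS -prodr_const_nat -big_split /=.
  by apply: eq_bigr => k _; rewrite -natrM mul2n.
transitivity (\prod_(1 <= k < n.+1)
  (2%:R * ((p - k)%:R / (p - k.*2)%:R)) : rat).
  apply: eq_big_nat => k kn; rewrite !natrB; try lia.
  have d0 : p%:R - k.*2%:R != 0 :> rat.
    by rewrite -natrB ?pnatr_eq0; lia.
  by rewrite -mul2n natrM in d0 *; field.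
rewrite big_split prodr_const_nat prodf_div /= e mulfK //.
by rewrite subSS subn0 -exprD addnn pE.
Qed.

Lemma fermat_quotient_tlog :
  tlog (fermat_quotient 2 p) -
    \sum_(1 <= k < n.+1) tlog (p - k.*2)%:R^-1 \in pideal p 3.
Proof.
have [|c [cL ec lc]] := tlog_prod n.+1 (fun k => (p - k.*2)%:R^-1).
  by move=> k kn; apply: locint_inv => //; lia.
rewrite (_ : fermat_quotient 2 p = c) //.
by rewrite /fermat_quotient -prod_odd_pow2 ec addrC addKr mulrC mulKf.
Qed.

(** The coefficients collect the linear, quadratic and cubic parts of [tlog]: [3/8 = 1/4 + 1/8] and
    [7/24 = 1/8 + 1/8 + 1/24]. *)
Lemma tlog_odd_sum :
  \sum_(1 <= k < n.+1) tlog (p - k.*2)%:R^-1 -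
    (- 2%:R^-1 * h 1 + - (3%:R / 8%:R * P) * h 2 +
     - (7%:R / 24%:R * P ^+ 2) * h 3)
   \in pideal p 3.
Proof.
apply: harm_approx => k kn.
have k2 : (0 < k.*2 < p)%N by lia.
have := (inv_flip1 k.*2 k2).
have := (inv_flip2 k.*2 k2).
have := (inv_flip3 k.*2 k2).
rewrite (inv_double k 1 : k.*2%:R^-1 = _) !expr1 !exprMn.
set y := (p - k.*2)%:R^-1; set x := k%:R^-1 => F3 F2 F1.
rewrite (_ : _ - _ =
  (y + (2^-1 * x + P * (2^-1 ^+ 2 * x ^+ 2) + P ^+ 2 * (2^-1 ^+ 3 * x ^+ 3)))
  - 2%:R^-1 * (P ^+ 1 * (y ^+ 2 -
      (2^-1 ^+ 2 * x ^+ 2 + 2%:R * P * (2^-1 ^+ 3 * x ^+ 3))))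
  + 3%:R^-1 * (P ^+ 2 * (y ^+ 3 + 2^-1 ^+ 3 * x ^+ 3))); last first.
  by rewrite /tlog; field.
apply: rpredD; first apply: rpredB => //.
  by apply: pidealZ; [lint | rewrite (pidealX _ p_prime _ 1 2)].
by apply: pidealZ; [lint | rewrite (pidealX _ p_prime _ 2 1)].
Qed.

Lemma harm_fermat_quotient q : q = fermat_quotient 2 p ->
  2%:R * q - P * q ^+ 2 + 2%:R / 3%:R * P ^+ 2 * q ^+ 3
      + 7%:R / 12%:R * P ^+ 2 * bernoulli (p - 3) + h 1 \in pideal p 3.
Proof.
move=> qE; have A := rpredD fermat_quotient_tlog tlog_odd_sum.
rewrite -qE in A.
have B := harm2_half.
have C := harm3_bernoulli.
rewrite -(pidealX _ p_prime _ 1 2) in B.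
rewrite -(pidealX _ p_prime _ 2 1) in C.
set s := \sum_(_ <= _ < _) _ in A.
(* Replacing [h_2] by [-7/6 p h_3] changes the coefficient of [p^2 h_3] from [-7/12] to [7/24], and
   [h_3 = -2 B_(p-3)] turns it into [-7/12]. *)
rewrite (_ : _ + _ = 2%:R * (tlog q - s + (s - (- 2%:R^-1 * h 1 +
     - (3%:R / 8%:R * P) * h 2 + - (7%:R / 24%:R * P ^+ 2) * h 3)))
  - 3%:R / 4%:R * (P ^+ 1 * (h 2 + 7%:R / 6%:R * P * h 3))
  + 7%:R / 24%:R * (P ^+ 2 * (h 3 + 2%:R * bernoulli (p - 3)))); last first.
  by rewrite /tlog; field.
have two : 2%:R^-1 \in locint p by lint.
have three : 3%:R^-1 \in locint p by lint.
have four : 4%:R^-1 \in locint p by rewrite (natrM _ 2 2) invfM; lint.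
(* 24 may exceed [p], so it is inverted through its factors. *)
have t24 : 24%:R^-1 \in locint p.
  by rewrite (natrM _ 6 4) (natrM _ 2 3) !invfM; lint.
apply: rpredD; first apply: rpredB.
- by apply: pidealZ => //; lint.
- by apply: pidealZ => //; lint.
- by apply: pidealZ => //; lint.
Qed.

(** * Values of [bsum p] at integers *)

Lemma bsum_diff_p a : a * (bsum p a - bsum p (a - 1)) = gbinom (a - 1) p.-1 - 1.
Proof.
have pS : p.-1.+1 = p by rewrite prednK ?prime_gt0.
have := bsum_diff p.-1 a; rewrite pS => ->.
by rewrite -signr_odd (_ : odd p.-1 = false) ?mul1r //; lia.
Qed.

(** Below [p - 1] the binomial in [bsum_diff_p] vanishes, so the step from [m] to [m + 1] subtracts
    [1/(m+1)]. *)
Lemma bsum_nat m : (m < p)%N -> bsum p m%:R = - harm 1 m.+1.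
Proof.
elim: m => [|m IHm] mp.
  rewrite harm1 oppr0 /bsum big_nat big1 // => k kp.
  by rewrite (gbinom_nat 0) bin0n (_ : k == 0%N = false) ?mulr0 //; lia.
have := bsum_diff_p m.+1%:R; rewrite -natr1 addrK gbinom_nat.
rewrite bin_small; last by lia.
rewrite IHm 1?ltnW // (harmS 1 m.+1) // -natr1 sub0r => e.
have m0 : m%:R + 1 != 0 :> rat by rewrite natr1 natrS_neq0.
apply: (mulfI m0); move/eqP: e; rewrite mulrBr subr_eq => /eqP ->.
by rewrite expr1; field.
Qed.

Lemma bsumN1 : bsum p (-1) = G 1.
Proof.
apply: eq_big_nat => k kp; rewrite gbinomN1 mulrAC -expr2 -exprM mulnC exprM.
by rewrite sqrrN !expr1n mul1r.
Qed.

(** The product of [(p + i)/(i + 1)] over [i < r], that is, the binomial coefficient of [p - 1 + r]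
    over [r]. It governs the jumps of [bsum p] both below [-1] and above [p]. *)
Definition cprod (r : nat) : rat := gbinom (- r%:R - 1) p.-1.

Lemma cprod0 : cprod 0 = 1.
Proof.
rewrite /cprod oppr0 sub0r gbinomN1 -signr_odd (_ : odd p.-1 = false) //; lia.
Qed.

Lemma cprodS r : r.+1%:R * cprod r.+1 = (P + r%:R) * cprod r.
Proof.
have e := gbinom_ratio (- r%:R - 1) p.-1.
have c : - r%:R - 1 = - r.+1%:R :> rat by rewrite -natr1 opprD.
rewrite -/(cprod r) predp_natr c -/(cprod r.+1) in e.
by apply: oppr_inj; rewrite -mulNr -e -natr1; ring.
Qed.

(** Replacing [a] by [p - 2 - a] in [gbinom a p.-1] reverses its [p - 1] factors and changes an even
    number of signs. *)
Lemma gbinom_cprod r : gbinom (P + r%:R - 1) p.-1 = cprod r.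
Proof.
elim: r => [|r IHr].
  by rewrite addr0 -predp_natr gbinom_nat binn cprod0.
apply: (mulfI (natrS_neq0 r)); rewrite cprodS -IHr -gbinom_ratio predp_natr.
by rewrite -natr1 addrA addrK; congr (_ * _); ring.
Qed.

(** Here [cprod r] is [p/r] times the product of [1 + p/i] over [0 < i < r], of which the constant
    and linear parts are kept. *)
Lemma cprod_mod r : (0 < r < p)%N ->
  cprod r - (P * r%:R^-1 + P ^+ 2 * harm 1 r * r%:R^-1) \in pideal p 3.
Proof.
elim: r => // -[|r] IHr rp.
  have := cprodS 0; rewrite cprod0 mul1r addr0 mulr1 => ->.
  by rewrite harm1 (_ : _ - _ = 0) ?rpred0 // invr1; ring.
have {}IHr := IHr ltac:(lia).
have HL : harm 1 r.+1 \in locint p by apply: locint_harm; lia.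
have [r0 r1] := (natrS_neq0 r, natrS_neq0 r.+1).
rewrite (_ : _ - _ = (P + r.+1%:R) * r.+2%:R^-1 *
   (cprod r.+1 - (P * r.+1%:R^-1 + P ^+ 2 * harm 1 r.+1 * r.+1%:R^-1))
   + P ^+ 3 * (harm 1 r.+1 * r.+1%:R^-1 * r.+2%:R^-1)).
  apply: rpredD; last by apply: pidealXW => //; lint.
  by apply: pidealZ => //; lint.
have -> : cprod r.+2 = r.+2%:R^-1 * ((P + r.+1%:R) * cprod r.+1).
  by rewrite -cprodS mulKf.
rewrite (harmS 1 r.+1) // expr1.
move: r.+1%:R r.+2%:R r0 r1 => x y x0 y0; field.
by rewrite x0 y0.
Qed.

Lemma bsum_neg m :
  bsum p (- m%:R - 1) = G 1 + \sum_(1 <= r < m.+1) (cprod r - 1) * r%:R^-1.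
Proof.
elim: m => [|m IHm]; first by rewrite big_geq // oppr0 sub0r bsumN1 addr0.
rewrite big_nat_recr //= addrA -IHm.
have := bsum_diff_p (- m.+1%:R); rewrite -/(cprod m.+1) => <-.
rewrite (_ : - m%:R - 1 = - m.+1%:R); last by rewrite -natr1 opprD.
have m0 := natrS_neq0 m.
by rewrite mulrAC mulNr divff // mulN1r opprB addrC subrK.
Qed.

Lemma bsum_pos m :
  bsum p (P + m%:R) =
  - G 1 + \sum_(1 <= r < m.+1) (cprod r - 1) * (P + r%:R)^-1.
Proof.
elim: m => [|m IHm].
  (* The jump at [p] is zero, so the value at [p] is the one at [p - 1], which [bsum_nat] covers. *)
  rewrite big_geq // !addr0; have := bsum_diff_p P.
  rewrite -predp_natr gbinom_nat binn subrr.
  rewrite (bsum_nat p.-1) ?prednK ?prime_gt0 //.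
  by move/eqP; rewrite mulf_eq0 (negPf p_neq0) /= subr_eq0 => /eqP.
rewrite big_nat_recr //= addrA -IHm.
have := bsum_diff_p (P + m.+1%:R); rewrite gbinom_cprod => <-.
rewrite (_ : P + m.+1%:R - 1 = P + m%:R); last by rewrite -natr1; ring.
have m0 : P + m.+1%:R != 0 by rewrite -natrD pnatr_eq0; lia.
by rewrite mulrAC divff // mul1r addrC subrK.
Qed.

Local Notation X := (nested n.+1).
Local Notation Z := (nested p).

Lemma bsum_neg_mod :
  bsum p (- n%:R - 1) - (G 1 - h 1 + P * h 2 + P ^+ 2 * X) \in pideal p 3.
Proof.
rewrite bsum_neg.
rewrite (_ : _ - _ = \sum_(1 <= r < n.+1) (cprod r - 1) * r%:R^-1 -
  (- h 1 + P * h 2 + P ^+ 2 * X)); last by ring.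
rewrite /harm /nested !mulr_sumr -sumrN -!big_split.
apply: pideal_sumB => r rn /=.
apply: (pideal_eq (pidealZ p r%:R^-1 _ _ _ (cprod_mod r ltac:(lia)))).
  by lint.
by ring.
Qed.

Lemma bsum_pos_mod :
  bsum p (P + n%:R) -
    (- G 1 - h 1 + 2%:R * P * h 2 - 2%:R * P ^+ 2 * h 3 + P ^+ 2 * X)
    \in pideal p 3.
Proof.
rewrite bsum_pos; set s := \sum_(_ <= _ < _) _.
rewrite (_ : - G 1 + s - _ = s -
  (- h 1 + 2%:R * P * h 2 + - (2%:R * P ^+ 2) * h 3 + P ^+ 2 * X));
  last by ring.
rewrite /s /harm /nested !mulr_sumr -sumrN -!big_split.
apply: pideal_sumB => r rn /=.
rewrite -/(harm 1 r).
have zL : (P + r%:R)^-1 \in locint p by apply: locint_inv_shift; lia.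
have HL : harm 1 r \in locint p by apply: locint_harm; lia.
rewrite (_ : _ - _ = (P + r%:R)^-1 *
    (cprod r - (P * r%:R^-1 + P ^+ 2 * harm 1 r * r%:R^-1)) +
  P ^+ 3 * ((P + r%:R)^-1 * (2%:R * r%:R^-1 ^+ 3 - harm 1 r * r%:R^-1 ^+ 2))).
  apply: rpredD; last by apply: pidealXW => //; lint.
  by apply: pidealZ => //; apply: cprod_mod; lia.
have r0 : r%:R != 0 :> rat by apply: natr_neq0; lia.
have m0 : P + r%:R != 0 by rewrite -natrD pnatr_eq0; lia.
by rewrite !expr1; field; rewrite ?r0 ?m0.
Qed.

(** * Nested sums modulo [p] *)

Lemma harm1_full1 : G 1 \in pideal p 1.
Proof.
rewrite -[G 1](subrK (P ^+ 2 * harm 3 n.+1 / 6%:R)).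
apply: rpredD; first by apply: pideal_le harm1_fullE.
rewrite -mulrA; apply: (@pideal_le p p_prime _ 2) => //; apply: pidealXW => //.
by rewrite (natrM _ 2 3) invfM; apply: rpredM; [apply: locint_harm; lia | lint].
Qed.

Lemma harm1_flip r : (r < p)%N -> harm 1 (p - r) - harm 1 r.+1 \in pideal p 1.
Proof.
elim: r => [|r IHr] rp; first by rewrite subn0 harm1 subr0 harm1_full1.
have {}IHr := IHr (ltnW rp).
have e : (p - r = (p - r.+1).+1)%N by lia.
rewrite e harmS in IHr; last by lia.
have F : (0 < r.+1 < p)%N by lia.
have xL : r.+1%:R^-1 \in locint p by lint.
rewrite harmS //.
rewrite (_ : _ - _ = harm 1 (p - r.+1) + (p - r.+1)%:R^-1 ^+ 1 - harm 1 r.+1 -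
  ((p - r.+1)%:R^-1 +
   (r.+1%:R^-1 + P * r.+1%:R^-1 ^+ 2 + P ^+ 2 * r.+1%:R^-1 ^+ 3))
  + P ^+ 1 * (r.+1%:R^-1 ^+ 2 + P * r.+1%:R^-1 ^+ 3)); last first.
  by rewrite !expr1; ring.
apply: rpredD; last by apply: pidealXW => //; lint.
by apply: rpredB => //; apply: pideal_le (inv_flip1 _ F).
Qed.

(** Modulo [p], the term of index [p - r] is [H_r / r^2] by [harm1_flip]; the last term [1/r] of
    [H_r] yields [h_3]. *)
Lemma nested_halves : Z - (2%:R * X + h 3) \in pideal p 1.
Proof.
have -> : Z = X + \sum_(1 <= r < n.+1) harm 1 (p - r) * (p - r)%:R^-1 ^+ 2.
  by rewrite /nested {1}pE big_nat_halves pE.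
rewrite (_ : _ - _ = \sum_(1 <= r < n.+1) harm 1 (p - r) * (p - r)%:R^-1 ^+ 2 -
  (X + h 3)); last by ring.
rewrite /nested {3}/harm -big_split; apply: pideal_sumB => r rn /=.
have rp : (0 < r < p)%N by lia.
have xL : r%:R^-1 \in locint p by lint.
have yL : (p - r)%:R^-1 \in locint p by lint.
have HL : harm 1 r \in locint p by apply: locint_harm; lia.
have A := harm1_flip r ltac:(lia).
have B := inv_flip2 r rp.
rewrite harmS in A; last by lia.
rewrite (_ : _ - _ =
  (p - r)%:R^-1 ^+ 2 * (harm 1 (p - r) - (harm 1 r + r%:R^-1 ^+ 1))
  + (harm 1 r + r%:R^-1) *
    ((p - r)%:R^-1 ^+ 2 - (r%:R^-1 ^+ 2 + 2%:R * P * r%:R^-1 ^+ 3))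
  + P ^+ 1 * (2%:R * r%:R^-1 ^+ 3 * (harm 1 r + r%:R^-1))); last first.
  by rewrite !expr1; ring.
apply: rpredD; last by apply: pidealXW => //; lint.
apply: rpredD; first by apply: pidealZ => //; lint.
by apply: pidealZ; [lint | apply: pideal_le B].
Qed.

(** The signed binomial is the product of [1 - p/i] over [1 <= i <= k], whose coefficients are
    elementary symmetric functions. *)
Lemma gbinom_predp_mod k : (k < p)%N ->
  (-1) ^+ k * gbinom (P - 1) k -
   (1 - P * harm 1 k.+1 + P ^+ 2 * ((harm 1 k.+1 ^+ 2 - harm 2 k.+1) / 2%:R))
  \in pideal p 3.
Proof.
elim: k => [|k IHk] kp.
  by rewrite gbinom0 !harm1 (_ : _ - _ = 0) ?rpred0 //; ring.
have {}IHk := IHk (ltnW kp).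
have two : 2%:R^-1 \in locint p by lint.
have H1L : harm 1 k.+1 \in locint p by apply: locint_harm; lia.
have H2L : harm 2 k.+1 \in locint p by apply: locint_harm; lia.
have xL : k.+1%:R^-1 \in locint p by lint.
have k0 := natrS_neq0 k.
have -> : gbinom (P - 1) k.+1 = (P * k.+1%:R^-1 - 1) * gbinom (P - 1) k.
  apply: (mulfI k0); rewrite gbinomS [RHS]mulrA; congr (_ * _).
  by rewrite mulrBr mulrCA divff // -natr1; ring.
rewrite (_ : _ - _ = (1 - P * k.+1%:R^-1) * ((-1) ^+ k * gbinom (P - 1) k -
   (1 - P * harm 1 k.+1 + P ^+ 2 * ((harm 1 k.+1 ^+ 2 - harm 2 k.+1) / 2%:R)))
  - P ^+ 3 * (k.+1%:R^-1 * ((harm 1 k.+1 ^+ 2 - harm 2 k.+1) / 2%:R))).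
  apply: rpredB; first by apply: pidealZ => //; lint.
  by apply: pidealXW => //; lint.
rewrite !(harmS _ k.+1) // expr1 exprS.
by move: k.+1%:R^-1 => x; field.
Qed.

(** Compares the exact value [- G_1] of [bsum p (p - 1)] with its expansion through
    [gbinom_predp_mod]. *)
Lemma nested_full : Z + h 3 / 2%:R \in pideal p 1.
Proof.
have two : 2%:R^-1 \in locint p by lint.
have three : 3%:R^-1 \in locint p by lint.
have p_gt0 : (0 < p)%N by exact: prime_gt0.
have A : bsum p (P - 1) - (G 1 - P * ((G 1 ^+ 2 + G 2) / 2%:R) +
    P ^+ 2 * ((G 1 ^+ 3 - 3%:R * G 1 * G 2 + 2%:R * G 3) / 6%:R + Z))
    \in pideal p 3.
  rewrite -sum_harm1 // -sum_elem2 // {1}/harm !mulr_sumr -sumrN -!big_split.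
  apply: pideal_sumB => k kp /=.
  apply: (pideal_eq (pidealZ p k%:R^-1 _ _ _ (gbinom_predp_mod k ltac:(lia)))).
    by lint.
  by rewrite expr1; ring.
rewrite -predp_natr bsum_nat ?prednK // in A.
have G1 := harm1_full1.
have G1L := pideal_locint _ p_prime _ _ G1.
have G2L : G 2 \in locint p by apply: locint_harm.
have E : (G 1 ^+ 3 - 3%:R * G 1 * G 2 + 2%:R * G 3) / 6%:R \in pideal p 1.
  rewrite (_ : _ / _ = 2%:R^-1 * 3%:R^-1 *
    ((G 1 ^+ 2 - 3%:R * G 2) * G 1 + 2%:R * G 3)); last by field.
  apply: pidealZ; first by lint.
  by apply: rpredD; apply: pidealZ => //; [lint | lint | exact: harm3_full].
rewrite -(pidealX _ p_prime _ 2 1) in E.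
rewrite -(pidealX _ p_prime _ 2 1).
have D := harm2_fullE; rewrite -(pidealX _ p_prime _ 1 2) in D.
have S := pidealM p (G 1) (G 1) 1 1 G1 G1.
rewrite -(pidealX _ p_prime _ 1 2) in S.
(* The [1/2] is [1/3] from [2 G_1] plus [1/6] from [- p G_2 / 2]. *)
rewrite (_ : P ^+ 2 * _ = - (- G 1 - (G 1 - P * ((G 1 ^+ 2 + G 2) / 2%:R) +
    P ^+ 2 * ((G 1 ^+ 3 - 3%:R * G 1 * G 2 + 2%:R * G 3) / 6%:R + Z)))
  - 2%:R * (G 1 - P ^+ 2 * h 3 / 6%:R)
  + 2%:R^-1 * (P ^+ 1 * (G 2 + P * h 3 / 3%:R))
  + 2%:R^-1 * (P ^+ 1 * (G 1 * G 1))
  - P ^+ 2 * ((G 1 ^+ 3 - 3%:R * G 1 * G 2 + 2%:R * G 3) / 6%:R));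
  last by field.
apply: rpredB => //; apply: rpredD; last by apply: pidealZ.
apply: rpredD; last by apply: pidealZ.
apply: rpredB; first by rewrite rpredN.
by apply: pidealZ; [lint | exact: harm1_fullE].
Qed.

(** * Interpolation at [-1/2] and the first congruence *)

Lemma bsum_half_mod : bsum p (- 2%:R^-1) + h 1 \in pideal p 3.
Proof.
have := quadmod_interp _ (quadmod_bsum n%:R p (rpred_nat _ _) (leqnn p)).
rewrite mulr0 addr0 mulr1 mulrN1 [n%:R + P]addrC.
have np : P = 2%:R * n%:R + 1 by rewrite pE -natr1 -mul2n natrM.
rewrite (_ : n%:R + P * - 2%:R^-1 = - 2%:R^-1); last by rewrite np; field.
rewrite (_ : n%:R - P = - n%:R - 1); last by rewrite np; ring.
rewrite bsum_nat; last by lia.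
move=> A; have B := bsum_neg_mod; have C := bsum_pos_mod.
have D := harm2_half; rewrite -(pidealX _ p_prime _ 1 2) in D.
have E := rpredB nested_full nested_halves.
rewrite -(pidealX _ p_prime _ 2 1) in E.
(* The interpolation weight 8 may exceed [p], hence three halvings. *)
do 3 apply: pideal_half.
(* Modulo [p^3], [4 G_1], [p h_2] and [2 p^2 X] contribute [2/3], [-7/6] and [-3/2] times [p^2 h_3],
   cancelling the [2 p^2 h_3] from [bsum_pos_mod]. *)
rewrite (_ : 2%:R * _ =
  (8%:R * bsum p (- 2%:R^-1) -
    (6%:R * - h 1 + 3%:R * bsum p (- n%:R - 1) - bsum p (P + n%:R)))
  + 3%:R * (bsum p (- n%:R - 1) - (G 1 - h 1 + P * h 2 + P ^+ 2 * X))
  - (bsum p (P + n%:R) -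
    (- G 1 - h 1 + 2%:R * P * h 2 - 2%:R * P ^+ 2 * h 3 + P ^+ 2 * X))
  + 4%:R * (G 1 - P ^+ 2 * h 3 / 6%:R)
  + P ^+ 1 * (h 2 + 7%:R / 6%:R * P * h 3)
  + P ^+ 2 * (Z + h 3 / 2%:R - (Z - (2%:R * X + h 3)))); last by field.
apply: rpredD => //; apply: rpredD => //; apply: rpredD.
  apply: rpredB => //; apply: rpredD => //; apply: pidealZ => //; lint.
by apply: pidealZ; [lint | exact: harm1_fullE].
Qed.

End Congruences.

Theorem theorem1p1 (p : nat) (p_prime : prime p) (p_gt3 : (3 < p)%N) :
  let q : rat := fermat_quotient 2 p in
  let P : rat := p%:R in
  let S : rat :=
    \sum_(1 <= k < p) (-1) ^+ k / k%:R * gbinom (- (1 / 2%:R)) k in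
  let M : rat :=
    2%:R * q - P * q ^+ 2 + 2%:R / 3%:R * P ^+ 2 * q ^+ 3
      + 7%:R / 12%:R * P ^+ 2 * bernoulli (p - 3) in
  let H : rat := \sum_(1 <= k < (p.-1 %/ 2).+1) 1 / k%:R in
  rat_eqmod p 3 S M /\ rat_eqmod p 3 M (- H).
Proof.
have pE : p = (p.-1 %/ 2).*2.+1.
  have : odd p by case: (even_prime p_prime) => [e|//]; lia.
  by lia.
move: (p.-1 %/ 2)%N pE => n pE.
have HL : harm 1 n.+1 \in locint p.
  by apply: (locint_harm p p_prime); lia.
move=> q P S M H.
have HE : harm 1 n.+1 = H by apply: eq_bigr => k _; rewrite expr1 div1r.
have SE : bsum p (- 2%:R^-1) = S by rewrite /S div1r.
have SH := bsum_half_mod p p_prime p_gt3 n pE.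
have MH := harm_fermat_quotient p p_prime p_gt3 n pE q erefl.
rewrite -/P -/M in MH.
rewrite SE HE in SH; rewrite HE in MH HL.
(* [rat_eqmod] also demands p-integral sides; for [S] and [M] this is inherited from [H]. *)
have SL : S \in locint p.
  by rewrite -(addrK H S) rpredB // (pideal_locint _ p_prime _ _ SH).
have ML : M \in locint p.
  by rewrite -(addrK H M) rpredB // (pideal_locint _ p_prime _ _ MH).
split; split=> //.
- by have := rpredB SH MH; rewrite (_ : _ - _ = S - M) //; ring.
- by rewrite -[p_integral p _]/(_ \in locint p) rpredN.
- by have := MH; rewrite -{1}[H]opprK.
Qed.
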